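(* Let $u$ be analytic on $\mathbb D$ and let $\varphi:\mathbb D\to\mathbb D$ be analytic, with $u\in\mathcal H(b)$ and $u\varphi\in\mathcal H(b)$. Then, for every polynomial $p$, the function $u\cdot (p\circ \varphi)$ belongs to $\mathcal H(b)$.
   Context: $\mathbb D$ is the open unit disk, $\mathbb T$ the unit circle; $H^2,H^\infty$ are the Hardy spaces of $\mathbb D$. $b$ is a fixed rational function in the closed unit ball of $H^\infty$ with $\|b\|_\infty=1$ that is not a finite Blaschke product (equivalently, not inner). Its Pythagorean mate $\tilde a$ is the unique outer function with $|\tilde a|^2+|b|^2=1$ a.e. on $\mathbb T$ and $\tilde a(0)>0$; it is rational, without zeros in $\mathbb D$ or poles in $\overline{\mathbb D}$. Its distinct zeros on $\mathbb T$ are $\zeta_1,\dots,\zeta_n$ ($n\ge1$) with multiplicities $m_1,\dots,m_n$; $N=\sum_i m_i$ and $a(z)=\prod_{i=1}^n(z-\zeta_i)^{m_i}$. $\mathcal P_{N-1}$ is the space of polynomials of degree at most $N-1$. The de Branges--Rovnyak space $\mathcal H(b)$ is, as a set, the direct sum $\mathcal H(b)=aH^2\oplus\mathcal P_{N-1}$. *)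

(* Defs.v *)
From HB Require Import structures.
From mathcomp Require Import all_boot all_order all_algebra.
From mathcomp Require Import complex.
From mathcomp Require Import all_classical all_reals all_analysis.
Import Order.TTheory GRing.Theory Num.Theory.
Import numFieldNormedType.Exports.

Set Implicit Arguments.
Unset Strict Implicit.
Unset Printing Implicit Defensive.

Local Open Scope classical_set_scope.
Local Open Scope complex_scope.
Local Open Scope ring_scope.

Section Disk.
Variable R : realType.
Local Notation C := R[i].
Local Notation mu := (@lebesgue_measure R).

(* The norm of [R[i]] takes values in [R[i]]; [cmod] is its real value. *)
Definition cmod (z : C) : R := complex.Re `|z|.

Definition disk : set C := [set z | `|z| < 1].

Definition cis (t : R) : C := cos t +i* sin t.

Definition cexp (z : C) : C := (expR (complex.Re z))%:C * cis (complex.Im z).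

(* Functions on the disk are total functions on [C] whose values outside the
   disk are irrelevant.  The difference quotients in [derivable] have complex
   increments, because [C^o] is a normed module over [C] itself. *)
Definition analytic_on_disk (f : C -> C) : Prop :=
  forall z, disk z -> derivable (f : C^o -> C^o) z 1.

Definition disk_self_map (f : C -> C) : Prop :=
  forall z, disk z -> disk (f z).

Definition Hinfty_norm (f : C -> C) : \bar R :=
  ereal_sup [set (cmod (f z))%:E | z in disk].

Definition Hinfty (f : C -> C) : Prop :=
  analytic_on_disk f /\ (Hinfty_norm f < +oo)%E.

Definition H2_mean (f : C -> C) (r : R) : \bar R :=
  (((2 * pi)^-1)%:E *
   \int[mu]_(t in `[0%R, (2 * pi)%R]) ((cmod (f (r%:C * cis t))) ^+ 2)%:E)%E.

Definition H2 (f : C -> C) : Prop :=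
  analytic_on_disk f /\ (ereal_sup [set H2_mean f r | r in `[0%R, 1%R[] < +oo)%E.

(* A rational function in lowest terms; its value at a pole is 0, by the
   convention [x / 0 = 0]. *)
Record ratfun := RatFun {
  rnum : {poly C};
  rden : {poly C};
  rden_neq0 : rden != 0;
  rat_coprime : coprimep rnum rden
}.

Definition ratfun_eval (f : ratfun) (z : C) : C := (rnum f).[z] / (rden f).[z].

Definition finite_Blaschke (f : C -> C) : Prop :=
  exists (gamma : C) (s : seq C),
    [/\ `|gamma| = 1,
        forall w, w \in s -> disk w
      & forall z, disk z ->
          f z = gamma * \prod_(w <- s) ((z - w) / (1 - (conjc w) * z))].

Definition Cintegral (f : R -> C) : C :=
  (\int[mu]_(t in `[0%R, (2 * pi)%R]) complex.Re (f t)) +i*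
  (\int[mu]_(t in `[0%R, (2 * pi)%R]) complex.Im (f t)).

(* [f z = gamma exp (1/2pi int (e^it + z)/(e^it - z) log psi(t) dt)] with
   [|gamma| = 1] and [k = log psi] integrable. *)
Definition outer (f : C -> C) : Prop :=
  exists (gamma : C) (k : R -> R),
    [/\ `|gamma| = 1,
        mu.-integrable `[0, 2 * pi] (EFin \o k)
      & forall z, disk z ->
          f z = gamma * cexp (((2 * pi)^-1)%:C *
            Cintegral (fun t => (cis t + z) / (cis t - z) * (k t)%:C))].

Definition pythagorean_mate (b a' : ratfun) : Prop :=
  [/\ outer (ratfun_eval a'),
      {ae mu, forall t : R,
        cmod (ratfun_eval a' (cis t)) ^+ 2 +
        cmod (ratfun_eval b (cis t)) ^+ 2 = 1}
    & 0 < ratfun_eval a' 0].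

(* [zeta] lists the distinct zeros of [f] on the unit circle and [m] their
   multiplicities; since [f] is in lowest terms, these are the multiplicities
   as roots of its numerator. *)
Definition circle_zeros (f : ratfun) (n : nat) (zeta : 'I_n -> C)
    (m : 'I_n -> nat) : Prop :=
  [/\ injective zeta,
      forall z : C, (`|z| = 1 /\ root (rnum f) z) <-> (exists i, z = zeta i)
    & forall i, m i = mup (zeta i) (rnum f)].

Definition zeros_poly (n : nat) (zeta : 'I_n -> C) (m : 'I_n -> nat) :
    {poly C} :=
  \prod_(i < n) ('X - (zeta i)%:P) ^+ m i.

(* The underlying set [a H^2 + P_(N-1)] of the de Branges-Rovnyak space H(b) of
   a rational non-inner [b], where [zeta] and [m] are the circle zeros of the
   Pythagorean mate of [b], [a = zeros_poly zeta m] and [N = \sum_i m i]. *)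
Definition deBranges_Rovnyak (n : nat) (zeta : 'I_n -> C) (m : 'I_n -> nat)
    (f : C -> C) : Prop :=
  exists (g : C -> C) (q : {poly C}),
    [/\ H2 g,
        (size q <= \sum_(i < n) m i)%N
      & forall z, disk z -> f z = (zeros_poly zeta m).[z] * g z + q.[z]].

End Disk.

(* Main.v *)
(** Write [u = a g + q] and [u phi = a h + t].  Then
    [q phi = t + a (h - phi g)] with [h - phi g] in [H^2].  Let [c] be the gcd
    of [q] and [a].  An [H^2] function is not bounded below by a multiple of
    [1 / |z - w|] near a point [w] of the circle: its square means over the
    circle of radius [1 - d] would be at least of order [1 / d], by
    integrating over an arc of length [d].  As [phi] is bounded, this forces
    [c] to divide [t].  Dividing by [c] and using a Bezout relation between
    [q / c] and [a / c] shows that [phi] is a polynomial plus an element of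
    [(a / c) H^2].  Bounded functions of this form are stable under products,
    so [p o phi] has this form too, and multiplying by [q] gives a polynomial
    plus an element of [a H^2]; the polynomial is finally reduced modulo
    [a]. *)
Require Import Defs.
From mathcomp Require Import all_boot all_order all_algebra.
From mathcomp Require Import complex.
From mathcomp Require Import all_classical all_reals all_analysis.
From mathcomp Require Import measurable_realfun ring lra.
Import Order.TTheory GRing.Theory Num.Theory.
Import numFieldNormedType.Exports.
Local Open Scope ring_scope.

Set Implicit Arguments.
Unset Strict Implicit.
Unset Printing Implicit Defensive.

Local Open Scope complex_scope.

(** * Real-valued modulus and points of the unit circle *)

Lemma cmodE (R : realType) (z : R[i]) : `|z| = (cmod z)%:C.
Proof. by []. Qed.

Lemma cmod_normc (R : realType) (z : R[i]) : cmod z = Normc.normc z.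
Proof. by []. Qed.

Lemma cmod_ge0 (R : realType) (z : R[i]) : 0 <= cmod z.
Proof. by rewrite -ler0c -cmodE. Qed.

Lemma cmodM (R : realType) (x y : R[i]) : cmod (x * y) = cmod x * cmod y.
Proof. exact: Normc.normcM. Qed.

Lemma cmodN (R : realType) (x : R[i]) : cmod (- x) = cmod x.
Proof. exact: normcN. Qed.

Lemma ler_cmodD (R : realType) (x y : R[i]) :
  cmod (x + y) <= cmod x + cmod y.
Proof. exact: le_normcD. Qed.

Lemma ler_cmodB (R : realType) (x y : R[i]) :
  cmod x - cmod y <= cmod (x - y).
Proof. by rewrite lerBlDr -{1}(subrK y x) ler_cmodD. Qed.

Lemma cmod_real (R : realType) (x : R) : cmod x%:C = `|x|.
Proof. by rewrite cmod_normc /= expr0n addr0 sqrtr_sqr. Qed.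

Lemma cmod_cis (R : realType) (t : R) : cmod (cis t) = 1.
Proof. by rewrite cmod_normc /= cos2Dsin2 sqrtr1. Qed.

Lemma diskE (R : realType) (z : R[i]) : disk z = (cmod z < 1) :> Prop.
Proof. by rewrite /disk /= cmodE -[1]/(1%:C) ltcR. Qed.

Lemma disk_polar (R : realType) (r t : R) :
  0 <= r < 1 -> disk (r%:C * cis t).
Proof.
by case/andP=> r0 r1; rewrite diskE cmodM cmod_real cmod_cis mulr1 ger0_norm.
Qed.

(** The mean value theorem is applied to [cos] and [sin] separately, which is why the constant is 2
    and not the optimal 1; any fixed constant would do for the arc estimate in [H2_no_pole]. *)
Lemma cis_lipschitz (R : realType) (s t : R) :
  cmod (cis t - cis s) <= 2 * `|t - s|.
Proof.
wlog st : s t / s <= t.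
  move=> H; have [|/ltW] := leP s t; first exact: H.
  by rewrite -cmodN opprB distrC; exact: H.
have lip (f df : R -> R) : (forall x, is_derive (x : R) (1 : R) f (df x)) ->
    (forall x, `|df x| <= 1) -> `|f t - f s| <= `|t - s|.
  move=> fdf df1.
  have [|c _ ->] := @MVT_segment R f df s t st (fun x _ => fdf x).
    by apply: derivable_within_continuous => x _; case: (fdf x).
  by rewrite normrM ler_piMl.
have -> : cis t - cis s =
    (cos t - cos s)%:C + (sin t - sin s)%:C * 'i.
  by apply/eqP; rewrite eq_complex /=; apply/andP; split; apply/eqP; ring.
apply: (le_trans (ler_cmodD _ _)); rewrite cmodM !cmod_real.
have -> : cmod 'i%C = 1 :> R.
  by rewrite cmod_normc /= expr0n add0r expr1n sqrtr1.
rewrite mulr1 mulr2n mulrDl mul1r lerD //.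
  apply: (lip (@cos R) (fun x => - sin x)) => x.
  by rewrite normrN ler_norml sin_geN1 sin_le1.
apply: (lip (@sin R) (@cos R)) => x.
by rewrite ler_norml cos_geN1 cos_le1.
Qed.

(** The arccosine of the real part is an angle for the closed upper half circle; the lower half is
    reached by reflecting it to [2 * pi - acos x]. *)
Lemma circle_cis (R : realType) (w : R[i]) : `|w| = 1 ->
  exists2 t : R, 0 <= t <= 2 * pi & w = cis t.
Proof.
case: w => x y; rewrite cmodE -[1]/(1%:C) => /complexI.
rewrite cmod_normc /= => /(congr1 (fun v => v ^+ 2)).
rewrite sqr_sqrtr ?addr_ge0 ?sqr_ge0 // expr1n => xy1.
have x1 : -1 <= x <= 1.
  by rewrite -ler_norml -(@ler_pXn2r _ 2) ?nnegrE // expr1n real_normK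
    ?num_real // -xy1 lerDl sqr_ge0.
have [/andP[a0 api] ca] := acos_def x1.
have sa : sin (acos x) = `|y|.
  by rewrite sin_acos // -xy1 addrAC subrr add0r sqrtr_sqr.
have pi0 := pi_ge0 R.
have [y0|y0] := leP 0 y.
  exists (acos x); first by rewrite a0 /=; lra.
  by rewrite /cis ca sa ger0_norm.
exists (2 * pi - acos x); first by apply/andP; split; lra.
rewrite /cis mulr_natl cosB sinB cos2pi sin2pi ca sa ltr0_norm //.
by congr (_ +i* _); ring.
Qed.

(** * Analytic functions and bounded functions on the disk *)

Lemma analytic_cst (R : realType) (c : R[i]) :
  analytic_on_disk (fun=> c).
Proof. by move=> z _; exact: derivable_cst. Qed.

Lemma analytic_id (R : realType) : analytic_on_disk (fun z : R[i] => z).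
Proof. by move=> z _; exact: derivable_id. Qed.

Lemma analyticD (R : realType) (f g : R[i] -> R[i]) :
  analytic_on_disk f -> analytic_on_disk g ->
  analytic_on_disk (fun z => f z + g z).
Proof. by move=> fa ga z zD; exact: (derivableD (fa z zD) (ga z zD)). Qed.

Lemma analyticM (R : realType) (f g : R[i] -> R[i]) :
  analytic_on_disk f -> analytic_on_disk g ->
  analytic_on_disk (fun z => f z * g z).
Proof. by move=> fa ga z zD; exact: (derivableM (fa z zD) (ga z zD)). Qed.

Lemma analytic_horner (R : realType) (p : {poly R[i]}) (f : R[i] -> R[i]) :
  analytic_on_disk f -> analytic_on_disk (fun z => p.[f z]).
Proof.
move=> fa; elim/poly_ind: p => [|p c IH].
  under eq_fun do rewrite horner0; exact: analytic_cst.
under eq_fun do rewrite hornerMXaddC.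
exact: analyticD (analyticM IH fa) (@analytic_cst _ c).
Qed.

Definition bounded_on_disk (R : realType) (f : R[i] -> R[i]) : Prop :=
  exists M : R, forall z, disk z -> cmod (f z) <= M.

Lemma bounded_on_disk_cst (R : realType) (c : R[i]) : bounded_on_disk (fun=> c).
Proof. by exists (cmod c). Qed.

Lemma bounded_on_diskD (R : realType) (f g : R[i] -> R[i]) :
  bounded_on_disk f -> bounded_on_disk g ->
  bounded_on_disk (fun z => f z + g z).
Proof.
move=> [M fM] [K gK]; exists (M + K) => z zD.
by rewrite (le_trans (ler_cmodD _ _)) // lerD ?fM ?gK.
Qed.

Lemma bounded_on_diskM (R : realType) (f g : R[i] -> R[i]) :
  bounded_on_disk f -> bounded_on_disk g ->
  bounded_on_disk (fun z => f z * g z).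
Proof.
move=> [M fM] [K gK]; exists (M * K) => z zD.
by rewrite cmodM ler_pM ?cmod_ge0 ?fM ?gK.
Qed.

Lemma bounded_on_disk_horner (R : realType) (p : {poly R[i]}) (f : R[i] -> R[i]) :
  bounded_on_disk f -> bounded_on_disk (fun z => p.[f z]).
Proof.
move=> fb; elim/poly_ind: p => [|p c IH].
  under eq_fun do rewrite horner0; exact: bounded_on_disk_cst.
under eq_fun do rewrite hornerMXaddC.
exact: bounded_on_diskD (bounded_on_diskM IH fb) (@bounded_on_disk_cst _ c).
Qed.

Lemma bounded_on_disk_id (R : realType) : bounded_on_disk (fun z : R[i] => z).
Proof. by exists 1 => z; rewrite diskE => /ltW. Qed.

Lemma bounded_on_disk_self_map (R : realType) (f : R[i] -> R[i]) :
  disk_self_map f -> bounded_on_disk f.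
Proof. by move=> fD; exists 1 => z /fD; rewrite diskE => /ltW. Qed.

(** * Integrals over circles and the space H^2 *)

Lemma continuous_circle (R : realType) (f : R[i] -> R[i]) (r : R) :
  analytic_on_disk f -> 0 <= r < 1 ->
  continuous (fun t : R => cmod (f (r%:C * cis t))).
Proof.
move=> fa r01 t; apply/cvgrPdist_lt => e e0.
have /derivable1_diffP/differentiable_continuous/cvgrPdist_lt := fa _ (disk_polar t r01).
have e0C : 0 < e%:C by rewrite -[0]/(0%:C) ltcR.
move=> /(_ e%:C e0C) /nbhs_ballP[d /= d0 dP].
(* The radius of a ball in [R[i]] is itself an element of [R[i]]; being positive, it is real. *)
have [d' dE] : exists d' : R, d = d'%:C.
  by move: d0; case: d {dP} => x y; rewrite ltcE /= => /andP[/eqP -> _]; exists x.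
have d'0 : 0 < d' by move: d0; rewrite dE -[0]/(0%:C) ltcR.
near=> s.
have : `|f (r%:C * cis t) - f (r%:C * cis s)| < e%:C.
  apply: dP; rewrite /ball /= cmodE dE ltcR -mulrBr cmodM cmod_real.
  have rn : `|r| <= 1 by rewrite ger0_norm; lra.
  apply: (@le_lt_trans _ _ (2 * `|t - s|)).
    by apply: le_trans (cis_lipschitz s t); rewrite ler_piMl ?cmod_ge0.
  rewrite mulrC -ltr_pdivlMr //.
  by near: s; apply: cvgr_dist_lt => //; rewrite divr_gt0.
rewrite cmodE ltcR; apply: le_lt_trans.
rewrite ler_norml lerNl opprB -{1}cmodN.
have := ler_cmodB (f (r%:C * cis t)) (f (r%:C * cis s)).
have := ler_cmodB (f (r%:C * cis s)) (f (r%:C * cis t)).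
rewrite -[X in _ <= X]cmodN opprB !cmodN => -> ->.
by [].
Unshelve. all: by end_near. Qed.

Lemma measurable_circle (R : realType) (f : R[i] -> R[i]) (r : R)
    (D : set R) : measurable D ->
  analytic_on_disk f -> 0 <= r < 1 ->
  measurable_fun D (EFin \o (fun t => cmod (f (r%:C * cis t)) ^+ 2)).
Proof.
move=> mD fa r01; apply/measurable_EFinP; apply: measurable_funX.
apply: measurable_funTS; apply: continuous_measurable_fun.
exact: continuous_circle.
Qed.

Lemma measurable_circleZ (R : realType) (f : R[i] -> R[i]) (r k : R)
    (D : set R) : measurable D ->
  analytic_on_disk f -> 0 <= r < 1 ->
  measurable_fun D (fun t => (k%:E * (cmod (f (r%:C * cis t)) ^+ 2)%:E)%E).
Proof.
by move=> mD fa r01; exact: measurable_funeM (measurable_circle mD fa r01).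
Qed.

(** Working form of membership in H^2: the factor 1 / (2 pi) is absorbed and the finite supremum
    becomes a real bound, so that later estimates compare plain integrals. *)
Lemma H2P (R : realType) (f : R[i] -> R[i]) :
  H2 f <-> analytic_on_disk f /\ exists M : R, forall r : R, 0 <= r < 1 ->
    (\int[@lebesgue_measure R]_(t in `[0%R, (2 * pi)%R])
      (cmod (f (r%:C * cis t)) ^+ 2)%:E <= M%:E)%E.
Proof.
have pi0 : 0 < 2 * pi :> R by rewrite mulr_gt0 // pi_gt0.
split=> -[fa].
  move=> supf; split => //.
  have [M [M0 HM]] : exists M : R, 0 <= M /\ forall r : R, 0 <= r < 1 -> (H2_mean f r <= M%:E)%E.
    set S := ereal_sup _ in supf.
    exists (Num.max 0 (fine S)); split; first by rewrite le_max lexx.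
    move=> r r01; have rS : (H2_mean f r <= S)%E.
      by apply: ereal_sup_ubound; exists r => //=; rewrite in_itv.
    apply: (le_trans rS); case: (S) supf => [x _|//|_]; last exact: leNye.
    by rewrite lee_fin le_max lexx orbT.
  exists (2 * pi * M) => r r01; have := HM r r01.
  by rewrite /H2_mean lee_pdivrMl.
move=> [M HM]; split=> //.
apply: (@le_lt_trans _ _ ((2 * pi)^-1 * M)%:E); last exact: ltry.
apply: ge_ereal_sup => x [r] /=; rewrite in_itv /= => r01 <-.
by rewrite /H2_mean EFinM lee_pmul2l ?lte_fin ?invr_gt0 //; exact: HM.
Qed.

Lemma H2_bounded_on_disk (R : realType) (f : R[i] -> R[i]) :
  analytic_on_disk f -> bounded_on_disk f -> H2 f.
Proof.
move=> fa [M fM]; apply/H2P; split => //; exists (M ^+ 2 * (2 * pi)) => r r01.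
have pi0 : 0 < 2 * pi :> R by rewrite mulr_gt0 // pi_gt0.
have -> : (M ^+ 2 * (2 * pi))%:E = (\int[@lebesgue_measure R]_(t in `[0%R, (2 * pi)%R])
    (cst (M ^+ 2)%:E t))%E.
  by rewrite integral_cst //= lebesgue_measure_itv /= lte_fin pi0 -EFinD subr0 EFinM.
apply: ge0_le_integral => //=.
- by move=> t _; rewrite lee_fin sqr_ge0.
- exact: measurable_circle.
- move=> t _; rewrite lee_fin ler_sqr ?nnegrE ?cmod_ge0 //.
    by apply: fM; exact: disk_polar.
  by apply: le_trans (fM _ (disk_polar t r01)); exact: cmod_ge0.
Qed.

(** Pointwise, |x + y|^2 is at most 2 |x|^2 + 2 |y|^2. *)
Lemma H2D (R : realType) (f g : R[i] -> R[i]) :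
  H2 f -> H2 g -> H2 (fun z => f z + g z).
Proof.
move=> /H2P[fa [M fM]] /H2P[ga [K gK]]; apply/H2P; split; first exact: analyticD.
exists (2 * M + 2 * K) => r r01.
apply: (@le_trans _ _ (\int[@lebesgue_measure R]_(t in `[0%R, (2 * pi)%R])
  (2%:E * (cmod (f (r%:C * cis t)) ^+ 2)%:E +
   2%:E * (cmod (g (r%:C * cis t)) ^+ 2)%:E))%E).
  apply: ge0_le_integral => //=.
  - by move=> t _; rewrite lee_fin sqr_ge0.
  - exact: measurable_circle _ (analyticD fa ga) r01.
  - by apply: emeasurable_funD; exact: measurable_circleZ.
  - move=> t _; rewrite -!EFinM -EFinD lee_fin.
    set x := f _; set y := g _.
    have : cmod (x + y) ^+ 2 <= (cmod x + cmod y) ^+ 2.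
      by rewrite ler_sqr ?nnegrE ?addr_ge0 ?cmod_ge0 ?ler_cmodD.
    have := sqr_ge0 (cmod x - cmod y); nra.
rewrite ge0_integralD //=; last first.
- exact: measurable_circleZ.
- by move=> t _; rewrite -EFinM lee_fin mulr_ge0 // sqr_ge0.
- exact: measurable_circleZ.
- by move=> t _; rewrite -EFinM lee_fin mulr_ge0 // sqr_ge0.
rewrite !ge0_integralZl_EFin //; try exact: measurable_circle;
  try by move=> t _; rewrite lee_fin sqr_ge0.
by rewrite (EFinD (2 * M)) !(EFinM 2); apply: leeD; rewrite lee_pmul2l ?lte_fin //; auto.
Qed.

Lemma H2M_bounded_on_disk (R : realType) (f g : R[i] -> R[i]) :
  analytic_on_disk f -> bounded_on_disk f -> H2 g -> H2 (fun z => f z * g z).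
Proof.
move=> fa [K fK] /H2P[ga [M gM]]; apply/H2P; split; first exact: analyticM.
exists (K ^+ 2 * M) => r r01.
apply: (@le_trans _ _ (\int[@lebesgue_measure R]_(t in `[0%R, (2 * pi)%R])
  ((K ^+ 2)%:E * (cmod (g (r%:C * cis t)) ^+ 2)%:E))%E).
  apply: ge0_le_integral => //=.
  - by move=> t _; rewrite lee_fin sqr_ge0.
  - exact: measurable_circle _ (analyticM fa ga) r01.
  - exact: measurable_circleZ.
  - move=> t _; rewrite -EFinM lee_fin cmodM exprMn ler_wpM2r ?sqr_ge0 //.
    have zD := disk_polar t r01; have z0 := cmod_ge0 (f (r%:C * cis t)).
    by rewrite ler_sqr ?nnegrE ?fK // (le_trans z0) ?fK.
rewrite ge0_integralZl_EFin ?sqr_ge0 //; first last.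
- exact: measurable_circle.
- by move=> t _; rewrite lee_fin sqr_ge0.
by rewrite (EFinM (K ^+ 2)) lee_wpmul2l ?lee_fin ?sqr_ge0 ?gM.
Qed.

(** * H^2 functions have no simple pole on the circle *)

(** Here [c] is the residue of [g - B] at [w]. If it were nonzero, |g| would be at least of order 1
    / d on an arc of length d near [w], and the integral of |g|^2 of order 1 / d, which exceeds [M]
    for small d. *)
Lemma H2_no_pole (R : realType) (g B : R[i] -> R[i]) (w c : R[i]) :
  H2 g -> bounded_on_disk B -> `|w| = 1 ->
  (forall z, disk z -> (z - w) * (g z - B z) = c) -> c = 0.
Proof.
move=> /H2P[ga [M gM]] [K BK] /circle_cis[th th02 ->] gBc.
apply/eqP; apply/negPn/negP => c0.
have k0 : 0 < cmod c by rewrite -[0]/(0 : R) -ltcR -cmodE normr_gt0.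
set k := cmod c in k0.
(* With d = 1 / (1 + X + Y), the three numbers d, d X and d Y are nonnegative and sum to 1. This
   yields d <= 1 together with the two smallness conditions [dK] and [dM]. *)
pose X := 6 * `|K| / k; pose Y := 36 * `|M| / k ^+ 2.
have X0 : 0 <= X by rewrite divr_ge0 ?mulr_ge0 // ltW.
have Y0 : 0 <= Y by rewrite divr_ge0 ?exprn_ge0 ?mulr_ge0 // ltW.
pose d := (1 + X + Y)^-1.
have D0 : 0 < 1 + X + Y by lra.
have d0 : 0 < d by rewrite invr_gt0.
have dE : d * (1 + X + Y) = 1 by rewrite mulVf // gt_eqF.
have dX0 : 0 <= d * X by rewrite mulr_ge0 // ltW.
have dY0 : 0 <= d * Y by rewrite mulr_ge0 // ltW.
have d1 : d <= 1 by lra.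
have dK : 6 * d * `|K| <= k.
  have -> : 6 * d * `|K| = (d * X) * k by rewrite /X; field; rewrite gt_eqF.
  by rewrite ger_pMl //; lra.
have dM : 36 * d * `|M| < k ^+ 2.
  have -> : 36 * d * `|M| = (d * Y) * k ^+ 2 by rewrite /Y; field; rewrite gt_eqF.
  by rewrite gtr_pMl ?exprn_gt0 //; lra.
have pi2 := pi_ge2 R.
have r01 : 0 <= 1 - d < 1 by apply/andP; split; lra.
(* The arc starts at [th] or ends there, according to the half of [0, 2 pi] containing [th], so that
   it never leaves the interval of integration. *)
have [a [a0 ad2 ath]] : exists a : R, [/\ 0 <= a, a + d <= 2 * pi &
    forall t, a <= t <= a + d -> `|t - th| <= d].
  have [thpi|thpi] := leP th pi.
    exists th; split; [lra|lra|move=> t /andP[t1 t2]].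
    by rewrite ler_norml; apply/andP; split; lra.
  exists (th - d); split; [lra|lra|move=> t /andP[t1 t2]].
  by rewrite ler_norml; apply/andP; split; lra.
have lower t : a <= t <= a + d -> (k / (6 * d)) ^+ 2 <= cmod (g ((1 - d)%:C * cis t)) ^+ 2.
  move=> /ath td; set z := _ * cis t.
  have zD : disk z by exact: disk_polar.
  (* The radial displacement contributes d and the angular one at most 2 d. *)
  have zw : cmod (z - cis th) <= 3 * d.
    have -> : z - cis th = (- d)%:C * cis t + (cis t - cis th).
      by rewrite /z rmorphB rmorphN /=; ring.
    apply: (le_trans (ler_cmodD _ _)); rewrite cmodM cmod_real cmod_cis.
    by have := cis_lipschitz th t; rewrite normrN (gtr0_norm d0); lra.
  have zw0 := cmod_ge0 (z - cis th).
  have g0 := cmod_ge0 (g z).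
  have kle : k <= cmod (z - cis th) * (cmod (g z) + `|K|).
    rewrite /k -(gBc z zD) cmodM ler_wpM2l //.
    apply: (le_trans (ler_cmodD _ _)); rewrite cmodN lerD2l.
    by apply: le_trans (BK z zD) _; exact: ler_norm.
  have K0 := normr_ge0 K.
  have : k <= 3 * d * (cmod (g z) + `|K|).
    by apply: (le_trans kle); rewrite ler_wpM2r // addr_ge0.
  (* By [dK], the term 3 d |K| is at most k / 2, so 3 d |g z| is at least k / 2. *)
  move=> kle'; have kg : k / (6 * d) <= cmod (g z).
    by rewrite ler_pdivrMr ?mulr_gt0 //; nra.
  by rewrite ler_sqr ?nnegrE // divr_ge0 ?mulr_ge0 // ltW.
have mI : measurable `[a, a + d]%classic by [].
have : (((k / (6 * d)) ^+ 2 * d)%:E <= M%:E)%E.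
  apply: le_trans (gM _ r01).
  apply: (@le_trans _ _ (\int[@lebesgue_measure R]_(t in `[a, (a + d)%R])
      (cmod (g ((1 - d)%:C * cis t)) ^+ 2)%:E)%E); last first.
    apply: ge0_subset_integral => //=.
    - exact: measurable_circle.
    - by move=> t _; rewrite lee_fin sqr_ge0.
    - by move=> t /=; rewrite !in_itv /= => /andP[? ?]; apply/andP; split; lra.
  have -> : ((k / (6 * d)) ^+ 2 * d)%:E = (\int[@lebesgue_measure R]_(t in `[a, (a + d)%R])
      cst ((k / (6 * d)) ^+ 2)%:E t)%E.
    by rewrite integral_cst //= lebesgue_measure_itv /= lte_fin ltrDl d0 -EFinD
      addrAC subrr add0r (EFinM (_ ^+ 2)).
  apply: ge0_le_integral => //=.
  - by move=> t _; rewrite lee_fin sqr_ge0.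
  - exact: measurable_circle.
rewrite lee_fin; apply/negP; rewrite -ltNge.
have -> : (k / (6 * d)) ^+ 2 * d = k ^+ 2 / (36 * d) by field; rewrite gt_eqF.
rewrite ltr_pdivlMr ?mulr_gt0 //.
by apply: le_lt_trans dM; rewrite mulrC ler_wpM2l ?ler_norm // mulr_ge0 // ltW.
Qed.

Lemma disk_circle_neq (R : realType) (z w : R[i]) :
  disk z -> `|w| = 1 -> z != w.
Proof. by move=> zD w1; apply/eqP => zw; move: zD; rewrite /disk /= zw w1 ltxx. Qed.

(** This permits cancelling such a product from identities on the disk. *)
Lemma horner_circle_neq0 (R : realType) (s : seq R[i]) (z : R[i]) :
  {in s, forall w, `|w| = 1} -> disk z ->
  (\prod_(w <- s) ('X - w%:P)).[z] != 0.
Proof.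
move=> s1 zD; rewrite -[_ == 0]/(root _ z) root_prod_XsubC.
by apply/negP => /s1/(disk_circle_neq zD)/eqP.
Qed.

(* At each root of the product, a remainder of [t] would force a simple pole
   on [G]. *)
Lemma dvdp_bounded_H2 (R : realType) (s : seq R[i]) (t : {poly R[i]})
    (B G : R[i] -> R[i]) :
  {in s, forall w, `|w| = 1} -> bounded_on_disk B -> H2 G ->
  (forall z, disk z ->
    let c := \prod_(w <- s) ('X - w%:P) in c.[z] * B z = t.[z] + c.[z] * G z) ->
  \prod_(w <- s) ('X - w%:P) %| t.
Proof.
move=> s1 Bb GH; elim: s s1 t => [|w s IH] s1 t /=.
  by rewrite big_nil dvd1p.
rewrite big_cons; set c := \prod_(_ <- s) _ => E.
have w1 : `|w| = 1 by apply: s1; rewrite mem_head.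
have s1' : {in s, forall x, `|x| = 1}.
  by move=> x xs; apply: s1; rewrite inE xs orbT.
have [t1 tE] : exists t1, t = t1 * ('X - w%:P) + (t.[w])%:P.
  have /factor_theorem[t1 t1E] : root (t - (t.[w])%:P) w.
    by rewrite /root !hornerE subrr.
  by exists t1; rewrite -t1E subrK.
(* Dividing [E] by z - w gives c G - (c B - t1) = - t(w) / (z - w): an H^2 function minus a bounded
   one, with residue - t(w) at [w]. *)
have tw0 : - t.[w] = 0.
  apply: (@H2_no_pole _ (fun z => c.[z] * G z)
    (fun z => c.[z] * B z + (- t1).[z]) w) => //.
  - apply: H2M_bounded_on_disk => //; last exact: bounded_on_disk_horner (@bounded_on_disk_id R).
    exact: analytic_horner (@analytic_id R).
  - apply: bounded_on_diskD; last exact: bounded_on_disk_horner (@bounded_on_disk_id R).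
    by apply: bounded_on_diskM => //; exact: bounded_on_disk_horner (@bounded_on_disk_id R).
  - move=> z zD; have := E z zD; rewrite {1}tE !hornerE => Ez.
    have -> : (z - w) * (c.[z] * G z - (c.[z] * B z - t1.[z])) =
      (z - w) * c.[z] * G z - (z - w) * c.[z] * B z + (z - w) * t1.[z] by ring.
    by rewrite Ez; ring.
rewrite tE -(opprK t.[w]) tw0 oppr0 addr0 mulrC dvdp_mul2r ?polyXsubC_eq0 //.
apply: IH => // z zD /=; rewrite -/c.
have zw : z - w != 0 by rewrite subr_eq0 disk_circle_neq.
apply: (mulfI zw); have := E z zD.
by rewrite {1}tE -(opprK t.[w]) tw0 oppr0 addr0 !hornerE => Ez; rewrite [LHS]Ez; ring.
Qed.

(** * Polynomials plus multiples of H^2 functions *)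

Lemma H2B (R : realType) (f g : R[i] -> R[i]) :
  H2 f -> H2 g -> H2 (fun z => f z - g z).
Proof.
move=> fH gH.
have -> : (fun z => f z - g z) = (fun z => f z + -1 * g z).
  by apply/funext => z; rewrite mulN1r.
apply: (H2D fH).
exact: (H2M_bounded_on_disk (@analytic_cst R (-1)) (@bounded_on_disk_cst R (-1))).
Qed.

Lemma H2M_poly (R : realType) (p : {poly R[i]}) (f : R[i] -> R[i]) :
  H2 f -> H2 (fun z => p.[z] * f z).
Proof.
apply: H2M_bounded_on_disk; first exact: analytic_horner (@analytic_id R).
exact: bounded_on_disk_horner (@bounded_on_disk_id R).
Qed.

(** The degree of the polynomial is left free, so no reduction modulo [c] is needed when products
    are formed. *)
Definition poly_add_mul_H2 (R : realType) (c : {poly R[i]})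
    (f : R[i] -> R[i]) : Prop :=
  exists (t : {poly R[i]}) (G : R[i] -> R[i]),
    H2 G /\ forall z, disk z -> f z = t.[z] + c.[z] * G z.

(** Horner induction. In (tp + c Gp) f only the factor f next to tp is expanded; next to Gp it is
    kept as a bounded multiplier, so two H^2 functions are never multiplied together. *)
Lemma poly_add_mul_H2_horner (R : realType) (c p : {poly R[i]})
    (f : R[i] -> R[i]) :
  analytic_on_disk f -> bounded_on_disk f ->
  poly_add_mul_H2 c f -> poly_add_mul_H2 c (fun z => p.[f z]).
Proof.
move=> fa fb [t [G [GH fE]]]; elim/poly_ind: p => [|p k [tp [Gp [GpH pE]]]].
  exists 0, (fun=> 0); split.
    by apply: H2_bounded_on_disk; [exact: analytic_cst|exact: bounded_on_disk_cst].
  by move=> z _; rewrite !horner0 mulr0 addr0.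
exists (tp * t + k%:P), (fun z => tp.[z] * G z + f z * Gp z); split.
  by apply: H2D; [exact: H2M_poly|exact: H2M_bounded_on_disk].
move=> z zD; rewrite hornerMXaddC (pE z zD) mulrDl {1}(fE z zD) !hornerE /=.
by ring.
Qed.

(** * Factorization over the circle zeros and Bezout relation *)

(** Each zero is listed as often as its multiplicity. Divisors then correspond to sublists, and
    induction can remove one linear factor at a time. *)
Lemma zeros_poly_prod_XsubC (R : realType) (n : nat) (zeta : 'I_n -> R[i])
    (m : 'I_n -> nat) : (forall i, `|zeta i| = 1) ->
  exists s : seq R[i], [/\ zeros_poly zeta m = \prod_(w <- s) ('X - w%:P),
    {in s, forall w, `|w| = 1} & size s = \sum_(i < n) m i].
Proof.
move=> zeta1; exists (flatten [seq nseq (m i) (zeta i) | i <- enum 'I_n]).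
split.
- rewrite /zeros_poly big_flatten /= big_map big_enum /=.
  by apply: eq_bigr => i _; rewrite big_nseq iter_mulr_1.
- by move=> w /flatten_mapP[i _]; rewrite mem_nseq => /andP[_ /eqP ->].
rewrite size_flatten /shape -map_comp sumnE big_map big_enum /=.
by apply: eq_bigr => i _; rewrite size_nseq.
Qed.

(** A divisor of a product of linear factors is, up to a scalar, the product over a sublist; [s'] is
    the sublist for the gcd of [q] with the product. *)
Lemma gcdp_prod_XsubC_Bezout (F : fieldType) (s : seq F) (q : {poly F}) :
  exists (s' : seq F) (q' a' v w : {poly F}),
    [/\ {subset s' <= s}, q = q' * \prod_(x <- s') ('X - x%:P),
        \prod_(x <- s) ('X - x%:P) = a' * \prod_(x <- s') ('X - x%:P)
      & v * q' + w * a' = 1].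
Proof.
set a := \prod_(x <- s) _.
have [m cE] := dvdp_prod_XsubC (dvdp_gcdr q a : _ %| \prod_(x <- s) ('X - x%:P)).
set c := \prod_(x <- mask m s) _ in cE.
have c0 : c != 0 by rewrite monic_neq0 ?monic_prod_XsubC.
have cq : c %| q by rewrite -(eqp_dvdl _ cE) dvdp_gcdl.
have ca : c %| a by rewrite -(eqp_dvdl _ cE) dvdp_gcdr.
have [[v w] /= vw] := Bezoutp q a.
have /eqpP[[k l] /= /andP[k0 l0] kl] := eqp_trans vw cE.
(* The factor k / l turns the Bezout relation, which holds only up to a unit, into an equality with
   the monic [c]. *)
exists (mask m s), (q %/ c), (a %/ c), ((k / l) *: v), ((k / l) *: w); split.
- by move=> x; exact: mem_mask.
- by rewrite divpK.
- by rewrite divpK.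
apply: (mulIf c0); rewrite mul1r mulrDl -!mulrA !divpK //.
by rewrite -!scalerAl -scalerDr mulrC -scalerA kl scalerA mulVf // scale1r.
Qed.

(** * Composition of polynomials with [phi] *)

Theorem theorem3p2 (R : realType)
  (b a' : ratfun R) (n : nat) (zeta : 'I_n -> R[i]) (m : 'I_n -> nat)
  (b_Hinfty : Hinfty (ratfun_eval b))
  (b_norm : Hinfty_norm (ratfun_eval b) = 1%E)
  (b_not_Blaschke : ~ finite_Blaschke (ratfun_eval b))
  (a'_mate : pythagorean_mate b a')
  (n_ge1 : (1 <= n)%N)
  (a'_zeros : circle_zeros a' zeta m)
  (u phi : R[i] -> R[i])
  (u_analytic : analytic_on_disk u)
  (phi_analytic : analytic_on_disk phi)
  (phi_self_map : disk_self_map phi)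
  (u_Hb : deBranges_Rovnyak zeta m u)
  (uphi_Hb : deBranges_Rovnyak zeta m (fun z => u z * phi z)) :
  forall p : {poly R[i]}, deBranges_Rovnyak zeta m (fun z => u z * p.[phi z]).
Proof.
move=> p.
have zeta1 i : `|zeta i| = 1.
  by have [_ zetaP _] := a'_zeros; have [|-> _] := (zetaP (zeta i)).2; first by exists i.
have [s [aE s1 sizes]] := zeros_poly_prod_XsubC m zeta1.
move: u_Hb uphi_Hb => [g [q [gH _ uE]]] [h [t [hH _ uphiE]]].
rewrite /deBranges_Rovnyak; rewrite {}aE in uE uphiE *.
have [s' [q' [a1 [v [w [s's qE a1E vw]]]]]] := gcdp_prod_XsubC_Bezout s q.
set a := \prod_(x <- s) _ in uE uphiE a1E *; set c := \prod_(x <- s') _ in qE a1E.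
have s'1 : {in s', forall x, `|x| = 1} by move=> x /s's/s1.
have phib := bounded_on_disk_self_map phi_self_map.
pose G z := h z - phi z * g z.
have GH : H2 G := H2B hH (H2M_bounded_on_disk phi_analytic phib gH).
have cphi z : disk z -> c.[z] * (q'.[z] * phi z) = t.[z] + c.[z] * (a1.[z] * G z).
  move=> zD; have := uphiE z zD; rewrite (uE z zD) a1E qE !hornerM /G => E.
  have -> : t.[z] = (a1.[z] * c.[z] * g z + q'.[z] * c.[z]) * phi z - a1.[z] * c.[z] * h z.
    by rewrite E; ring.
  by ring.
have q'phib := bounded_on_diskM (bounded_on_disk_horner q' (@bounded_on_disk_id R)) phib.
have /dvdpP[t1 tE] := dvdp_bounded_H2 s'1 q'phib (H2M_poly a1 GH) cphi.
have phi_poly : poly_add_mul_H2 a1 phi.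
  (* Cancelling c gives q' phi = t1 + a1 G. Multiplying by v and adding w a1 phi, the Bezout
     relation turns the left side into phi. *)
  exists (v * t1), (fun z => v.[z] * G z + w.[z] * phi z); split.
    exact: (H2D (H2M_poly v GH) (H2M_poly w (H2_bounded_on_disk phi_analytic phib))).
  move=> z zD; have c0 := horner_circle_neq0 s'1 zD.
  have q'phi : q'.[z] * phi z = t1.[z] + a1.[z] * G z.
    by apply: (mulfI c0); rewrite (cphi z zD) tE hornerM; ring.
  have /(congr1 (fun r => r.[z])) := vw; rewrite !hornerE => vwz.
  rewrite -[LHS]mul1r -vwz mulrDl -(mulrA v.[z]) q'phi.
  by ring.
have [r [H [HH pE]]] := poly_add_mul_H2_horner p phi_analytic phib phi_poly.
(* From u p(phi) = a g p(phi) + q (r + a1 H): since q a1 = q' a, the H term is a multiple of a, and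
   q r is divided by a. The last factor 1 is the constant function, as an element of H^2. *)
exists (fun z => p.[phi z] * g z + q'.[z] * H z + (q * r %/ a).[z] * 1), (q * r %% a).
have a0 : a != 0 by rewrite monic_neq0 ?monic_prod_XsubC.
split.
- have pg := H2M_bounded_on_disk (@analytic_horner R p _ phi_analytic)
    (bounded_on_disk_horner p phib) gH.
  have H1 := H2_bounded_on_disk (@analytic_cst R 1) (@bounded_on_disk_cst R 1).
  exact: (H2D (H2D pg (H2M_poly q' HH)) (H2M_poly (q * r %/ a) H1)).
(* The size of [a] is N + 1, so the remainder has size at most N, that is, degree at most N - 1. *)
- by rewrite -ltnS -sizes -(size_prod_XsubC s id) ltn_modp.
move=> z zD.
have /(congr1 (fun f => f.[z])) := divp_eq (q * r) a; rewrite hornerD !hornerM => E.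
have qz : q.[z] = q'.[z] * c.[z] by rewrite qE hornerM.
have az : a.[z] = a1.[z] * c.[z] by rewrite a1E hornerM.
transitivity (a.[z] * (p.[phi z] * g z) + q.[z] * r.[z] + a.[z] * (q'.[z] * H z)).
  by rewrite (uE z zD) mulrDl {2}(pE z zD) qz az; ring.
by rewrite E; ring.
Qed.
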